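(* Let $d\ge 3$ be an integer and let $f(\xi)=\sum_{i,j,k,\ell=1}^d C_{ijk\ell}\,\xi_{ij}\xi_{k\ell}$, $\xi\in\mathbb R^{d\times d}$, be a real quadratic form (with $C$ a real fourth-order tensor) that is quasiconvex. Let $T(y)$ be the $y$-matrix (acoustic tensor) of $f$. Assume that the polynomial $\det T(y)$ in $y\in\mathbb R^d$ is an irreducible extremal polynomial. Then $f$ is an extremal form.
   Context: All polynomials and forms have real coefficients; irreducible means irreducible in $\mathbb R[y_1,\dots,y_d]$. Quasiconvexity: a quadratic form $f$ on $\mathbb R^{d\times d}$ is quasiconvex (for quadratic forms this is equivalent to rank-one convexity) if and only if $f(x\otimes y)\ge 0$ for all $x,y\in\mathbb R^d$, where $x\otimes y=(x_iy_j)_{i,j}$. This may be taken as the definition. One writes $f(x,y)$ for $f(x\otimes y)$. $y$-matrix (acoustic tensor): the unique symmetric $d\times d$ matrix $T(y)$, whose entries are quadratic forms in $y$, such that $f(x\otimes y)=x\,T(y)\,x^T$ for all $x,y\in\mathbb R^d$ ($x$ a row vector). Rank-one form: the square $\big(\sum_{i,j}b_{ij}\xi_{ij}\big)^2$ of a (nonzero) linear form on $\mathbb R^{d\times d}$. Extremal form: a quasiconvex quadratic form $f$ is extremal if one cannot subtract a rank-one form from it while preserving quasiconvexity, i.e. there is no nonzero matrix $B\in\mathbb R^{d\times d}$ with $f(x\otimes y)-(xBy^T)^2\ge 0$ for all $x,y\in\mathbb R^d$. Extremal polynomial: a homogeneous polynomial $P$ of even degree $2m$ in $n$ variables is extremal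 if $P\ge 0$ on $\mathbb R^n$ and $P$ cannot be written as a sum of two nonnegative polynomials that are linearly independent. *)

(* Defs.v *)
From HB Require Import structures.
From mathcomp Require Import all_boot all_order all_algebra.
From mathcomp Require Import reals.
From mathcomp Require Export mpoly.

Set Implicit Arguments.
Unset Strict Implicit.
Unset Printing Implicit Defensive.

Import Order.TTheory GRing.Theory Num.Theory.
Local Open Scope ring_scope.

(* Polynomials in y_1, ..., y_d are elements of {mpoly R[d]}; vectors are row
   vectors 'rV[R]_d, and [y 0 : 'I_d -> R] is the coordinate function of y. *)

Definition quad_form (R : realType) (d : nat)
    (C : 'I_d -> 'I_d -> 'I_d -> 'I_d -> R) (xi : 'M[R]_d) : R :=
  \sum_i \sum_j \sum_k \sum_l C i j k l * xi i j * xi k l.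

Definition tensor (R : realType) (d : nat) (x y : 'rV[R]_d) : 'M[R]_d :=
  x^T *m y.

(* Used for quadratic forms only, where nonnegativity on rank-one matrices
   may be taken as the definition of quasiconvexity. *)
Definition quasiconvex (R : realType) (d : nat) (f : 'M[R]_d -> R) : Prop :=
  forall x y : 'rV[R]_d, 0 <= f (tensor x y).

Definition rank_one_form (R : realType) (d : nat) (B xi : 'M[R]_d) : R :=
  (\sum_i \sum_j B i j * xi i j) ^+ 2.

Definition extremal_form (R : realType) (d : nat) (f : 'M[R]_d -> R) : Prop :=
  quasiconvex f /\
  forall B : 'M[R]_d, B != 0 ->
    ~ quasiconvex (fun xi => f xi - rank_one_form B xi).

(* These conditions determine T, since the symmetric matrix of a quadratic form
   is unique and a real polynomial is determined by its values. *)
Definition is_y_matrix (R : realType) (d : nat) (f : 'M[R]_d -> R)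
    (T : 'M[{mpoly R[d]}]_d) : Prop :=
  [/\ T^T = T,
      forall i j, T i j \is 2.-homog &
      forall x y : 'rV[R]_d,
        f (tensor x y) = (x *m map_mx (meval (y 0)) T *m x^T) 0 0].

Definition irreducible_elt (A : comUnitRingType) (p : A) : Prop :=
  [/\ p != 0, p \isn't a GRing.unit &
      forall a b : A, p = a * b ->
        a \is a GRing.unit \/ b \is a GRing.unit].

Definition nonneg_poly (R : realType) (n : nat) (P : {mpoly R[n]}) : Prop :=
  forall v : 'I_n -> R, 0 <= P.@[v].

Definition lin_indep2 (R : nzRingType) (V : lmodType R) (u v : V) : Prop :=
  forall a b : R, a *: u + b *: v = 0 -> a = 0 /\ b = 0.

(* The summands Q1, Q2 are not assumed homogeneous. *)
Definition extremal_poly (R : realType) (n : nat) (P : {mpoly R[n]}) : Prop :=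
  [/\ exists m : nat, P \is m.*2.-homog,
      nonneg_poly P &
      ~ exists Q1 Q2 : {mpoly R[n]},
          [/\ nonneg_poly Q1, nonneg_poly Q2, lin_indep2 Q1 Q2 &
              P = Q1 + Q2]].

(* Main.v *)
Require Import Defs.
From mathcomp Require Import all_boot all_order all_algebra.
From mathcomp Require Import reals boolp polyrcf.
Import Order.TTheory GRing.Theory Num.Theory.
Local Open Scope ring_scope.

(* Write v = B y and p = det T. If f minus the square of the form x -> x B y^T
   were still quasiconvex, then T + c v v^T would be positive semidefinite for
   every c >= -1, so its determinant p + c Q, with Q = v^T adj(T) v, would be
   nonnegative; in particular Q >= 0 and p - Q >= 0, and extremality of p forces
   Q = l p. The adjugate identity for a rank-one update then shows that p
   divides every (w_i)^2, where w = adj(T) v. Polynomial rings over a field are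
   factorial, so the irreducible p is prime and w = p z, whence T z = v. The
   entries of T are homogeneous of degree 2 and those of v of degree 1, so
   v = 0 and B = 0. *)

Set Implicit Arguments.
Unset Strict Implicit.
Unset Printing Implicit Defensive.

(** * Divisibility, primes and factorial domains *)

Definition rdvd {A : idomainType} (a b : A) : Prop := exists c, b = c * a.

Definition prime_elt {A : idomainType} (p : A) : Prop :=
  [/\ p != 0, p \isn't a GRing.unit &
      forall a b, rdvd p (a * b) -> rdvd p a \/ rdvd p b].

Inductive prime_product {A : idomainType} : A -> Prop :=
| PrimeProductUnit u : u \is a GRing.unit -> prime_product u
| PrimeProductCons p a : prime_elt p -> prime_product a -> prime_product (p * a).

(** Factoriality is encoded as the existence of prime factorizations; uniqueness then follows from
    primality of the factors. *)
Definition is_factorial (A : idomainType) : Prop :=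
  forall a : A, a != 0 -> prime_product a.

Section Divisibility.

Context {A : idomainType}.
Implicit Types a b c p q : A.

Lemma rdvd_mull c a b : rdvd a b -> rdvd a (c * b).
Proof. by case=> d ->; exists (c * d); rewrite mulrA. Qed.

Lemma rdvd_mulr c a b : rdvd a b -> rdvd a (b * c).
Proof. by rewrite mulrC; exact: rdvd_mull. Qed.

Lemma rdvdD a b c : rdvd a b -> rdvd a c -> rdvd a (b + c).
Proof. by move=> [d ->] [e ->]; exists (d + e); rewrite mulrDl. Qed.

Lemma rdvdN a b : rdvd a b -> rdvd a (- b).
Proof. by move=> [d ->]; exists (- d); rewrite mulNr. Qed.

Lemma rdvd_trans a b c : rdvd a b -> rdvd b c -> rdvd a c.
Proof. by move=> ab [d ->]; exact: rdvd_mull. Qed.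

Lemma rdvd_unit a b : b \is a GRing.unit -> rdvd a b -> a \is a GRing.unit.
Proof. by move=> + [c bE]; rewrite bE unitrM => /andP[]. Qed.

Lemma prime_product_mul a b :
  prime_product a -> prime_product b -> prime_product (a * b).
Proof.
move=> + pb; elim=> [u uu|p c pp _ IH].
  2: by rewrite -mulrA; apply: PrimeProductCons.
elim: pb => [v vu|p c pp _ IH]; first by apply: PrimeProductUnit; rewrite unitrM uu.
by rewrite mulrCA; apply: PrimeProductCons.
Qed.

Lemma prime_rdvdX p a n : prime_elt p -> rdvd p (a ^+ n) -> rdvd p a.
Proof.
move=> [p0 pnu pM]; elim: n => [|n IH].
  by rewrite expr0 => /(rdvd_unit (unitr1 _)) u; rewrite u in pnu.
by rewrite exprS => /pM[].
Qed.

(** Write [q = c * p]. The prime [q] divides [c] or [p]; if it divided [c], cancelling [q] would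
    make [p] a unit. *)
Lemma prime_rdvd_prime p q : prime_elt p -> prime_elt q -> rdvd p q -> rdvd q p.
Proof.
move=> [p0 pnu _] [q0 qnu qM] [c qE].
have: rdvd q (c * p) by exists 1; rewrite mul1r.
case/qM=> // -[e cE]; case/negP: pnu.
apply/unitrP; exists e; rewrite mulrC; split=> //; last rewrite mulrC.
all: by apply: (mulIf q0); rewrite mul1r [in RHS]qE cE; rewrite -!mulrA [q * p]mulrC mulrCA.
Qed.

End Divisibility.

(** Split off one prime factor [q] of [p]. Irreducibility makes the cofactor a unit, so [p] is
    associate to [q]. *)
Lemma factorial_irreducible_prime (A : idomainType) (p : A) :
  is_factorial A -> irreducible_elt p -> prime_elt p.
Proof.
move=> fA [p0 pnu pI].
have pp := fA p p0; case: pp p0 pnu pI => [u uu|q a qp _] p0 pnu pI; first by rewrite uu in pnu.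
have [q0 qnu qM] := qp.
case: (pI q a erefl) => [qu|ua]; first by rewrite qu in qnu.
split=> // b c /(rdvd_trans _) qbc.
have /qM : rdvd q (b * c) by apply: qbc; exists a; rewrite mulrC.
suff h : forall x, rdvd q x -> rdvd (q * a) x by case=> /h; [left|right].
by move=> x [y ->]; exists (y / a); rewrite -mulrA [_^-1 * _]mulrCA mulVr // mulr1.
Qed.

(** * Gauss's lemma: univariate polynomials over a factorial domain *)

Section PolynomialsOverFactorial.

Context {A : idomainType}.
Implicit Types f g h : {poly A}.

Lemma prime_polyC (p : A) : prime_elt p -> prime_elt p%:P.
Proof.
move=> [p0 pnu pM]; split; first by rewrite polyC_eq0.
  by rewrite poly_unitE size_polyC p0 coefC.
(* Induction on the total size, removing a leading term divisible by [p]. *)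
suff H n : forall f g, (size f + size g <= n)%N ->
    rdvd p%:P (f * g) -> rdvd p%:P f \/ rdvd p%:P g.
  by move=> f g; apply: H (leqnn _).
elim: n => [|n IH] f g.
  by rewrite leqn0 addn_eq0 !size_poly_eq0 => /andP[/eqP-> _]; left; exists 0; rewrite mul0r.
have main f1 g1 : (size f1 + size g1 <= n.+1)%N -> rdvd p%:P (f1 * g1) ->
    rdvd p (lead_coef f1) -> rdvd p%:P f1 \/ rdvd p%:P g1.
  move=> sz d [c lE].
  have [->|f0] := eqVneq f1 0; first by left; exists 0; rewrite mul0r.
  pose t := lead_coef f1 *: 'X^((size f1).-1).
  have td : rdvd p%:P t by exists (c *: 'X^((size f1).-1)); rewrite mulrC mul_polyC scalerA -[p * c]mulrC -lE.
  have szd : (size (f1 - t)%R < size f1)%N.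
    rewrite [X in (_ < X)%N]polySpred // ltnS; apply/leq_sizeP => j.
    rewrite leq_eqVlt coefB /t coefZ coefXn => /orP[/eqP <-|lt].
      by rewrite eqxx mulr1 lead_coefE subrr.
    rewrite gtn_eqF // mulr0 subr0 nth_default //.
    by rewrite [size f1]polySpred.
  case: (IH (f1 - t) g1).
  - by rewrite -ltnS (leq_trans _ sz) // ltn_add2r.
  - by rewrite mulrBl; apply: rdvdD d _; apply: rdvdN; apply: rdvd_mulr.
  - by move=> d1; left; rewrite -(subrK t f1); apply: rdvdD.
  by right.
move=> sz d.
have : rdvd p (lead_coef f * lead_coef g).
  case: (d) => q E; exists (lead_coef q); rewrite -lead_coefM E lead_coefM lead_coefC //.
case/pM => l; first exact: main.
by rewrite or_comm; apply: main; rewrite 1?addnC 1?mulrC.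
Qed.

Lemma prime_product_polyC (a : A) : prime_product a -> prime_product a%:P.
Proof.
elim=> [u uu|p b pp _ IH]; first by apply: PrimeProductUnit; apply: rmorph_unit.
by rewrite polyCM; apply: PrimeProductCons => //; apply: prime_polyC.
Qed.

(** The primes of [c] stay prime as constants and do not divide [f], so each divides [h] and cancels
    there. This turns a pseudo-division identity into true divisibility. *)
Lemma rdvd_cancel_coprime_const (c : A) f g h : prime_product c ->
  (forall p : A, prime_elt p -> rdvd p c -> ~ rdvd p%:P f) ->
  c%:P * g = f * h -> rdvd f g.
Proof.
move=> pc; elim: pc h => [u uu|p b pp _ IH] h cop E.
  exists (u^-1%:P * h); rewrite -mulrA [h * f]mulrC -E mulrA -polyCM mulVr // mul1r //.
have [p0 pnu pM] := prime_polyC pp.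
have : rdvd p%:P (f * h) by rewrite -E polyCM -mulrA mulrC; exists (b%:P * g).
case/pM.
  by move/(cop p pp); case; exists b; rewrite mulrC.
case=> h' hE; apply: (IH h').
  by move=> q qp qb; apply: cop => //; apply: rdvd_mull.
by apply: (mulfI p0); rewrite mulrA -polyCM E hE [RHS]mulrC -mulrA.
Qed.

(** Each prime of [c] divides [g] or [h] and is cancelled there, so a factorization over the
    fraction field descends to [A] with the same degrees. *)
Lemma clear_const_factor (c : A) f g h : prime_product c -> c%:P * f = g * h ->
  exists g' h', [/\ f = g' * h', size g' = size g & size h' = size h].
Proof.
move=> pc; elim: pc g h => [u uu|p b pp _ IH] g h E.
  exists (u^-1%:P * g), h; split=> //; first by rewrite -mulrA -E mulrA -polyCM mulVr // mul1r.
  by rewrite mul_polyC size_scale // invr_eq0; apply: contraTneq uu => ->; rewrite unitr0.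
have [p0 pnu pM] := prime_polyC pp.
have np0 : p != 0 by rewrite -polyC_eq0.
have szE q : size (q * p%:P) = size q by rewrite mulrC mul_polyC size_scale.
have : rdvd p%:P (g * h) by rewrite -E polyCM -mulrA mulrC; exists (b%:P * f).
case/pM => -[q qE].
  have [|g' [h' [-> s1 s2]]] := IH q h.
    by apply: (mulfI p0); rewrite mulrA -polyCM E qE -mulrA mulrCA.
  by exists g', h'; rewrite s1 s2 qE szE.
have [|g' [h' [-> s1 s2]]] := IH g q.
  by apply: (mulfI p0); rewrite mulrA -polyCM E qE [in RHS]mulrC -mulrA.
by exists g', h'; rewrite s1 s2 qE szE.
Qed.

(** A constant dividing [f] divides its leading coefficient, so this is primitivity: no prime
    constant divides [f]. *)
Definition primitive_at_lead f :=
  forall p : A, prime_elt p -> rdvd p (lead_coef f) -> ~ rdvd p%:P f.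

(* [b] collects the part of the leading coefficient whose prime factors are
   already known not to divide [f]. *)
Lemma primitive_decomposition (a b : A) f : prime_product a ->
  lead_coef f = b * a -> (forall p : A, prime_elt p -> rdvd p b -> ~ rdvd p%:P f) ->
  exists c f0, f = c%:P * f0 /\ primitive_at_lead f0.
Proof.
move=> pa; elim: pa b f => [u uu|p c pp _ IH] b f lE cop.
  exists 1, f; split; first by rewrite mul1r.
  move=> p pp; rewrite lE => -[x xE]; apply: cop => //.
  by exists (x / u); rewrite mulrAC -xE mulrK.
have [p0 pnu pM] := pp.
have [[f1 fE]|nd] := EM (rdvd p%:P f).
  have lf1 : lead_coef f1 = b * c.
    by apply: (mulIf p0); rewrite -mulrA [c * p]mulrC -lE fE lead_coefM lead_coefC.
  have [|e [f0 [f1E prim]]] := IH b f1 lf1.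
    by move=> q qp qb qf1; apply: (cop q qp qb); rewrite fE; apply: rdvd_mulr.
  by exists (e * p), f0; split=> //; rewrite fE f1E polyCM mulrAC.
apply: (IH (b * p) f); first by rewrite lE mulrA.
move=> q qp; have [q0 qnu qM] := qp.
case/qM=> [qb|qdp qf]; first exact: cop.
(* Here [q] divides [p], hence is associate to it, and [p] would divide [f]. *)
apply: nd; apply: rdvd_trans qf.
have [e eE] := prime_rdvd_prime qp pp qdp.
by exists e%:P; rewrite eE polyCM.
Qed.

(** Over a domain, [%|] means divisibility up to a nonzero constant, that is, over the fraction
    field. There [f] divides [g] or is coprime to it, and primitivity brings the divisibility back
    to [A]. *)
Lemma primitive_irreducible_prime f : is_factorial A ->
  (1 < size f)%N -> irreducible_poly f -> primitive_at_lead f -> prime_elt f.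
Proof.
move=> fA szf irr prim.
have f0 : f != 0 by rewrite -size_poly_gt0 ltnW.
have dvd g : f %| g -> rdvd f g.
  rewrite Pdiv.Idomain.dvdp_eq => /eqP E.
  apply: (@rdvd_cancel_coprime_const (lead_coef f ^+ scalp g f) f g (g %/ f)).
  - by apply: fA; rewrite expf_neq0 // lead_coef_eq0.
  - by move=> p pp /(prime_rdvdX pp); apply: prim.
  - by rewrite mul_polyC E mulrC.
split=> //; first by rewrite poly_unitE (gtn_eqF szf).
move=> g h [k E].
have fgh : f %| g * h by rewrite E dvdp_mulIr.
have [co|nco] := boolP (coprimep f g).
  by right; apply: dvd; rewrite -(Gauss_dvdpr _ co).
left; apply: dvd; rewrite /coprimep in nco.
have /eqp_dvdl <- := irr _ nco (dvdp_gcdl _ _).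
exact: dvdp_gcdr.
Qed.

Lemma factorial_poly : is_factorial A -> is_factorial {poly A}.
Proof.
move=> fA f; have [n] := ubnP (size f); elim: n f => // n IH f szf f0.
have [f1|fn1] := eqVneq (size f) 1%N.
  have /size_poly1P[c c0 ->] : size f == 1%N by rewrite f1.
  by apply: prime_product_polyC; apply: fA.
have szf1 : (1 < size f)%N by rewrite ltn_neqAle eq_sym fn1 size_poly_gt0.
(* A proper divisor over the fraction field gives [c *: f = r * q]; clearing [c] leaves two factors
   of smaller size. *)
have [[q [q1 qf nq]]|nq] := EM (exists q : {poly A}, [/\ size q != 1%N, q %| f & ~~ (q %= f)]).
  have [[c r] /= c0 /= cE] := Pdiv.Idomain.dvdpP _ _ qf.
  have rq0 : r * q != 0 by rewrite -cE -mul_polyC mulf_eq0 polyC_eq0 negb_or c0.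
  have [r0 q0] : r != 0 /\ q != 0 by move: rq0; rewrite mulf_eq0 negb_or => /andP[].
  have szq1 : (1 < size q)%N by rewrite ltn_neqAle eq_sym q1 size_poly_gt0.
  have szq : (size q < size f)%N by rewrite ltn_neqAle (dvdp_size_eqp qf) nq dvdp_leq.
  have szr : (size r < size f)%N.
    have: size (c *: f) = size f by apply: size_scale.
    rewrite cE size_mul // => <-.
    by case: (size q) szq1 => [|[|k]] // _; rewrite addnS /= addnS ltnS leq_addr.
  rewrite -mul_polyC in cE.
  have [r' [q' [fE s1 s2]]] := clear_const_factor (fA _ c0) cE.
  have [r'0 q'0] : r' != 0 /\ q' != 0 by move: f0; rewrite fE mulf_eq0 negb_or => /andP[].
  rewrite fE; apply: prime_product_mul; apply: IH => //.
    by rewrite s1 -ltnS (leq_trans _ szf) // ltnS.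
  by rewrite s2 -ltnS (leq_trans _ szf) // ltnS.
(* Now [f] is irreducible over the fraction field. Its content is extracted starting from [b = 1],
   which no prime divides. *)
have l0 : lead_coef f != 0 by rewrite lead_coef_eq0.
have [|p pp [d dE] _|c [f1 [fE prim]]] := @primitive_decomposition _ 1 f (fA _ l0).
- by rewrite mul1r.
- by have [_ + _] := pp; case/negP; apply/unitrP; exists d; rewrite -dE mulrC -dE.
have c0 : c != 0 by apply: contraNneq f0 => c0; rewrite fE c0 mul0r.
have ff1 : f %= f1 by rewrite fE mul_polyC eqp_scale.
rewrite fE; apply: prime_product_mul.
  exact: prime_product_polyC (fA _ c0).
rewrite -[f1]mulr1; apply: PrimeProductCons; last by apply: PrimeProductUnit; rewrite unitr1.
apply: primitive_irreducible_prime => //; first by rewrite -(eqp_size ff1).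
split; first by rewrite -(eqp_size ff1).
move=> q q1 qf1; rewrite -(eqp_rtrans ff1); apply/negPn/negP => nqf.
by apply: nq; exists q; split=> //; rewrite (eqp_dvdr _ ff1).
Qed.

End PolynomialsOverFactorial.

(** * Factoriality of multivariate polynomial rings *)

Lemma factorial_iso (A B : idomainType) (f : {rmorphism A -> B}) :
  bijective f -> is_factorial B -> is_factorial A.
Proof.
move=> bij fB a a0; have [g fK gK] := bij; have fI := can_inj fK.
have rdvd_f x y : rdvd (f x) (f y) <-> rdvd x y.
  split=> -[c E]; last by exists (f c); rewrite E rmorphM.
  by exists (g c); apply: fI; rewrite E rmorphM gK.
have unit_f x : f x \is a GRing.unit -> x \is a GRing.unit.
  move=> /unitrP[y [yx xy]]; apply/unitrP; exists (g y).
  by split; apply: fI; rewrite rmorphM gK rmorph1.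
have: f a != 0 by rewrite -(rmorph0 f) (inj_eq fI).
move/fB; move fa : (f a) => b pb; elim: pb a fa {a0} => [u uu|p c [p0 pnu pM] _ IH] a fa.
  by apply: PrimeProductUnit; apply: unit_f; rewrite fa.
have -> : a = g p * g c by apply: fI; rewrite rmorphM !gK.
apply: PrimeProductCons; last by apply: IH; rewrite gK.
split; first by rewrite -(inj_eq fI) rmorph0 gK.
  by apply: contra pnu => /(rmorph_unit f); rewrite gK.
by move=> x y /rdvd_f; rewrite rmorphM gK => /pM; rewrite -{1 2}(gK p) !rdvd_f.
Qed.

Lemma mpoly_rmorph_eq (R S : nzRingType) n (f g : {rmorphism {mpoly R[n]} -> S}) :
  (forall c, f c%:MP = g c%:MP) -> (forall i, f 'X_i = g 'X_i) -> f =1 g.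
Proof.
move=> fgC fgX p; rewrite [p]mpolyE !rmorph_sum; apply: eq_bigr => m _.
rewrite -mul_mpolyC !rmorphM fgC; congr (_ * _).
rewrite mpolyXE_id !rmorph_prod; apply: eq_bigr => i _.
by rewrite !rmorphXn fgX.
Qed.

Section MpolyFactorial.

Context {R : fieldType}.

Lemma muni_widen n (i : 'I_n) :
  muni ('X_(widen_ord (leqnSn n) i) : {mpoly R[n.+1]}) = ('X_i)%:P.
Proof.
rewrite /muni mmapX mmap1U; case: splitP => [j /= ij|j /= ij].
  by congr ('X__)%:P; apply/val_inj.
by have := ltn_ord i; rewrite ij ltnNge leq_addr.
Qed.

Lemma muni_ord_max n : muni ('X_ord_max : {mpoly R[n.+1]}) = 'X.
Proof.
rewrite /muni mmapX mmap1U; case: splitP => // j /= nj.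
by have := ltn_ord j; rewrite -nj ltnn.
Qed.

Lemma muni_mwiden n (p : {mpoly R[n]}) : muni (mwiden p) = p%:P.
Proof.
apply: (@mpoly_rmorph_eq _ _ _ (@muni n R \o @mwiden n R) polyC) => [c|i] /=.
  by rewrite mwidenC muniC.
by rewrite mwidenX mnmwiden1 muni_widen.
Qed.

(** [muni] singles out the last variable. Its inverse widens the coefficients and evaluates at
    ['X_ord_max]. *)
Lemma muni_bij n : bijective (@muni n R).
Proof.
pose g q := (map_poly (@mwiden n R) q).['X_ord_max].
have gK : cancel g (@muni n R).
  move=> q; rewrite /g -horner_map /= muni_ord_max -map_poly_comp.
  by rewrite (eq_map_poly (@muni_mwiden n)) -[RHS]comp_polyXr.
exists g => //.
(* [horner_morph] presents the inverse as a ring morphism, so that checking constants and variables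
   suffices. *)
apply: (@mpoly_rmorph_eq _ _ _ (horner_morph (fun p => mulrC 'X_ord_max (mwiden p)) \o @muni n R) idfun) => [c|i] /=.
  by rewrite muniC /horner_morph map_polyC hornerC /= mwidenC.
rewrite /horner_morph; have [lt|ge] := ltnP i n.
  have -> : i = widen_ord (leqnSn n) (Ordinal lt) by apply/val_inj.
  by rewrite muni_widen map_polyC hornerC /= mwidenX mnmwiden1.
have -> : i = ord_max by apply/val_inj/eqP; rewrite /= eqn_leq ge -ltnS ltn_ord.
by rewrite muni_ord_max map_polyX hornerX.
Qed.

Lemma factorial_mpoly n : is_factorial {mpoly R[n]}.
Proof.
elim: n => [|n IH]; last exact: factorial_iso (muni_bij n) (factorial_poly IH).
move=> p p0; apply: PrimeProductUnit; rewrite [p]nvar0_mpolyC.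
apply: rmorph_unit; rewrite unitfE; apply: contraNneq p0 => p0.
by rewrite [p]nvar0_mpolyC p0.
Qed.

End MpolyFactorial.

(** * Determinant and adjugate of a rank-one update *)

Section RankOneUpdate.

Context {A : idomainType} {n : nat}.
Variables (M : 'M[A]_n) (u : 'cV[A]_n) (v : 'rV[A]_n).

(** The matrix determinant lemma without division. The block matrix [X] is made triangular in two
    ways: by row operations clearing [u], and by a column operation through [\adj M] that costs a
    factor [\det M], cancelled at the end. *)
Lemma det_rank_one_update : \det M != 0 ->
  \det (M + u *m v) = \det M + (v *m \adj M *m u) 0 0.
Proof.
move=> M0; apply: (mulIf M0).
pose X : 'M_(1 + n) := block_mx 1%:M (- v) u M.
have EX : \det X = \det (M + u *m v).
  have : \det (block_mx 1%:M 0 (- u) 1%:M *m X) = \det (M + u *m v).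
    rewrite mulmx_block !mul1mx !mul0mx !addr0 mulmx1 addNr det_ublock det1 mul1r.
    by rewrite mulNmx mulmxN opprK addrC.
  by rewrite det_mulmx det_lblock !det1 !mul1r.
rewrite -EX; transitivity (\det (X *m block_mx (\det M)%:M 0 (- (\adj M *m u)) 1%:M)).
  by rewrite det_mulmx det_lblock det1 mulr1 det_scalar1.
rewrite mulmx_block !mul1mx mulNmx !mulmxN opprK !mulmx0 !mulmx1 !add0r.
rewrite mulmxA mulmxA mul_mx_adj -scalar_mxC subrr det_ublock; congr (_ * _).
by rewrite det_mx11 mxE mxE eqxx mulr1n.
Qed.

(** The Sherman-Morrison formula with denominators cleared. It is checked after left multiplication
    by [M + u *m v], which is injective because its determinant is nonzero. *)
Lemma adj_rank_one_update : \det M != 0 -> \det (M + u *m v) != 0 ->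
  \det M *: \adj (M + u *m v) =
  \det (M + u *m v) *: \adj M - \adj M *m u *m (v *m \adj M).
Proof.
move=> M0; have := det_rank_one_update M0; set S := M + u *m v => dS S0.
apply/eqP; rewrite -subr_eq0; apply/eqP; set D := (X in X = 0).
suff SD : S *m D = 0.
  have: \adj S *m (S *m D) = 0 by rewrite SD mulmx0.
  by rewrite mulmxA mul_adj_mx mul_scalar_mx => /eqP; rewrite scalemx_eq0 (negPf S0) => /eqP.
set Q := (v *m \adj M *m u) 0 0 in dS.
have QE : v *m \adj M *m u = Q%:M by rewrite [LHS]mx11_scalar.
rewrite /D !mulmxBr -!scalemxAr mul_mx_adj {2 3}/S !mulmxDl mul_mx_adj.
have -> : M *m (\adj M *m u *m (v *m \adj M)) = \det M *: (u *m (v *m \adj M)).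
  by rewrite !mulmxA mul_mx_adj mul_scalar_mx -!scalemxAl.
have -> : u *m v *m (\adj M *m u *m (v *m \adj M)) = Q *: (u *m (v *m \adj M)).
  rewrite -mulmxA [v *m (_ *m _)]mulmxA [v *m _]mulmxA QE mul_scalar_mx.
  by rewrite -!scalemxAr.
rewrite -/S -mulmxA -scalerDl -dS scalerDr addrK !scale_scalar_mx.
by rewrite mulrC subrr.
Qed.

End RankOneUpdate.

(** * Determinants of positive semidefinite matrices *)

Section PositiveSemidefinite.

Context {R : realType} {n : nat}.

(* [char_poly (- M)] takes the value [det M] at 0 and is eventually positive;
   a positive root would be minus an eigenvalue of [M]. *)
Lemma det_psd_ge0 (M : 'M[R]_n) :
  (forall x : 'rV_n, 0 <= (x *m M *m x^T) 0 0) -> 0 <= \det M.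
Proof.
move=> psd; rewrite leNgt; apply/negP => dM.
pose q := char_poly (- M).
have q0 : q.[0] = \det M.
  by rewrite horner_coef0 char_poly_det -scaleN1r detZ mulrA -exprD addnn -signr_odd odd_double mul1r.
have [N HN] : exists N, forall x, x >= N -> q.[x] >= lead_coef q.
  by apply: poly_pinfty_gt_lc; rewrite (monicP (char_poly_monic _)).
have [] := @poly_ivt R q 0 (Num.max 0 N); first by rewrite le_max lexx.
  rewrite q0 (ltW dM) (le_trans _ (HN _ _)) ?le_max ?lexx ?orbT //.
  by rewrite (monicP (char_poly_monic _)).
move=> x /andP[x0 _] rx.
have xgt0 : 0 < x.
  rewrite lt_neqAle x0 andbT; apply: contraTneq rx => <-.
  by rewrite /root q0 lt_eqF.
move: rx; rewrite -eigenvalue_root_char => /eigenvalueP[v vM v0].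
have := psd v; rewrite -[M]opprK mulmxN mulNmx vM -scalemxAl mxE mxE oppr_ge0.
rewrite pmulr_rle0 // mxE leNgt => /negP; apply.
have [i vi] : exists i, v 0 i != 0.
  apply/existsP; apply: contraNT v0; rewrite negb_exists => /forallP v0.
  by apply/eqP/rowP => i; rewrite mxE; apply/eqP; rewrite -[_ == _]negbK.
rewrite (bigD1 i) //= mxE -expr2 ltr_pwDl //; first by rewrite exprn_even_gt0.
by apply: sumr_ge0 => j _; rewrite mxE -expr2 sqr_ge0.
Qed.

End PositiveSemidefinite.

(** * Degrees in [T z = v], and the divisibility that produces [z] *)

Lemma mcoeffU_mul_2homog (R : nzRingType) n (p q : {mpoly R[n]}) i :
  p \is 2.-homog -> (p * q)@_U_(i) = 0.
Proof.
move=> hp; rewrite mcoeffM big1 // => k /eqP kE.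
rewrite (dhomog_nemf_coeff hp) ?mul0r //.
by apply/eqP => d2; have := mdeg1 i; rewrite kE mdegD d2.
Qed.

(** Every term of [T *m z] has degree at least two, whatever [z] is; comparing coefficients of
    degree one gives the claim. *)
Lemma mul_2homog_mx_linear_eq0 (R : nzRingType) n d (T : 'M[{mpoly R[d]}]_n)
    (z : 'cV[{mpoly R[d]}]_n) (B : 'M[R]_(n, d)) :
  (forall i j, T i j \is 2.-homog) ->
  T *m z = \col_i \sum_j B i j *: 'X_j -> B = 0.
Proof.
move=> hT /colP E; apply/matrixP => i j.
have := congr1 (mcoeff U_(j)) (E i); rewrite !mxE !raddf_sum /=.
rewrite big1 => [|k _]; last exact: mcoeffU_mul_2homog.
rewrite (bigD1 j) //= big1 => [|k kj].
  by rewrite mcoeffZ mcoeffXU eqxx mulr1 addr0 => <-.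
by rewrite mcoeffZ mcoeffXU (negPf kj) mulr0.
Qed.

(** The scalar [c] keeps [\det (T + c v v^T) = (1 + c l) \det T] nonzero, as the adjugate update
    requires. Modulo [\det T], the diagonal of that identity reads [c w_i^2 = 0]. *)
Lemma det_irreducible_dvd_adj (A : idomainType) n (T : 'M[A]_n) (v : 'cV[A]_n)
    (c l : A) :
  is_factorial A -> T^T = T -> irreducible_elt (\det T) ->
  c \is a GRing.unit -> 1 + c * l != 0 ->
  (v^T *m \adj T *m v) 0 0 = l * \det T ->
  exists z, T *m z = v.
Proof.
move=> fA symT irr cu cl0 QE; have [p0 pnu pM] := factorial_irreducible_prime fA irr.
set p := \det T in p0 pnu pM QE *.
pose w := \adj T *m v.
have wT : v^T *m \adj T = w^T by rewrite /w trmx_mul trmx_adj symT.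
have dS : \det (T + c *: v *m v^T) = (1 + c * l) * p.
  rewrite det_rank_one_update // -scalemxAr mxE QE mulrA -/p.
  by rewrite -[X in X + _]mul1r -mulrDl.
have [X E] : exists X, p *: X = ((1 + c * l) * p) *: \adj T - c *: (w *m w^T).
  exists (\adj (T + c *: v *m v^T)).
  by rewrite adj_rank_one_update ?dS ?mulf_neq0 // -scalemxAr -scalemxAl wT.
have wdvd i : rdvd p (w i 0).
  suff : rdvd p (w i 0 * w i 0) by case/pM.
  have : p * X i i = (1 + c * l) * p * \adj T i i - c * (w i 0 * w i 0).
    by move: (\adj T) (w) E => Y w1 /matrixP/(_ i i); rewrite !mxE big_ord1 mxE.
  move=> Ei; exists (c^-1 * ((1 + c * l) * \adj T i i - X i i)).
  apply: (mulrI cu); rewrite !mulrA mulrV // mul1r mulrBl.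
  by rewrite [X i i * p]mulrC Ei [in RHS]mulrAC subKr mulrA.
have [z zE] : exists z : 'cV[A]_n, w = p *: z.
  have /choice[z zE] : forall i, exists z, w i 0 = z * p by move=> i; exact: wdvd.
  by exists (\col_i z i); apply/colP => i; rewrite zE mxE mxE mulrC.
exists z; apply/colP => i; apply: (mulfI p0).
have : T *m w = p *: v by rewrite /w mulmxA mul_mx_adj mul_scalar_mx.
by rewrite zE -scalemxAr => /colP/(_ i); rewrite !mxE.
Qed.

(** * From quasiconvexity and extremality to [Q = l p] *)

Section LinearSymbol.

Context {R : realType} {d : nat}.

Definition linear_symbol (B : 'M[R]_d) : 'cV[{mpoly R[d]}]_d :=
  \col_i \sum_j B i j *: 'X_j.

Lemma rank_one_form_tensor (B : 'M[R]_d) (x y : 'rV[R]_d) :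
  rank_one_form B (tensor x y) =
  ((x *m map_mx (meval (y 0)) (linear_symbol B)) 0 0) ^+ 2.
Proof.
congr (_ ^+ 2); rewrite mxE; apply: eq_bigr => i _.
rewrite !mxE raddf_sum mulr_sumr; apply: eq_bigr => j _.
by rewrite /= mevalZ mevalXU /tensor mxE big_ord1 !mxE mulrCA.
Qed.

Lemma rank_one_quadratic (x : 'rV[R]_d) (u : 'cV[R]_d) :
  (x *m (u *m u^T) *m x^T) 0 0 = ((x *m u) 0 0) ^+ 2.
Proof.
by rewrite mulmxA -mulmxA -trmx_mul mxE big_ord1 [(_)^T _ _]mxE ord1 expr2.
Qed.

(** At each [y], [\det T + c Q] is affine in [c] and nonnegative for [c >= -1]. Hence its slope [Q]
    is nonnegative, and [c = -1] gives the other bound. *)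
Lemma adj_form_bounds (f : 'M[R]_d -> R) (T : 'M[{mpoly R[d]}]_d) (B : 'M[R]_d) :
  is_y_matrix f T -> quasiconvex f ->
  quasiconvex (fun xi => f xi - rank_one_form B xi) -> \det T != 0 ->
  let Q := ((linear_symbol B)^T *m \adj T *m linear_symbol B) 0 0 in
  nonneg_poly Q /\ nonneg_poly (\det T - Q).
Proof.
move=> [symT homT fT] qcf qcB p0 Q; set v := linear_symbol B in Q *.
have H y c : -1 <= c -> 0 <= (\det T).@[y] + c * Q.@[y].
  move=> c1; pose S := T + (c%:MP *: v) *m v^T.
  have -> : (\det T).@[y] + c * Q.@[y] = (\det S).@[y].
    rewrite det_rank_one_update // mevalD -scalemxAr mxE mevalM mevalC //.
  rewrite -det_map_mx; apply: det_psd_ge0 => x.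
  pose yr : 'rV[R]_d := \row_i y i.
  have Ey : meval (yr 0) =1 meval y by move=> q; apply: meval_eq => i; rewrite mxE.
  have := qcB x yr; rewrite rank_one_form_tensor.
  have := qcf x yr; rewrite fT.
  rewrite !(eq_map_mx _ Ey) -/v.
  have -> : map_mx (meval y) S = map_mx (meval y) T + c *: (map_mx (meval y) v *m (map_mx (meval y) v)^T).
    by rewrite map_mxD map_mxM map_mxZ map_trmx scalemxAl /= mevalC.
  have -> : (x *m (map_mx (meval y) T + c *: (map_mx (meval y) v *m (map_mx (meval y) v)^T)) *m x^T) 0 0
      = (x *m map_mx (meval y) T *m x^T) 0 0 + c * (x *m map_mx (meval y) v) 0 0 ^+ 2.
    by rewrite mulmxDr mulmxDl -scalemxAr -scalemxAl mxE [X in _ + X]mxE rank_one_quadratic.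
  set a := (_ *m _) 0 0; set b := (_ ^+ 2); move=> a0 ab.
  have b0 : 0 <= b by apply: sqr_ge0.
  (* The form [a + c b] is [(a - b) + (c + 1) b], a sum of two nonnegative terms. *)
  have : 0 <= (c + 1) * b by rewrite mulr_ge0 // -lerBlDr sub0r.
  by rewrite mulrDl mul1r => /(addr_ge0 ab); rewrite addrACA addNr addr0.
split=> y; last first.
  have := H y (-1) (lexx _); rewrite mulN1r mevalB //.
have P0 : 0 <= (\det T).@[y] by have := H y 0; rewrite mul0r addr0; apply; rewrite oppr_le0 ler01.
rewrite leNgt; apply/negP => Q0.
(* This [c], nonnegative when [Q < 0], makes [\det T + c Q] equal to [-1] at [y]. *)
have c1 : -1 <= - ((\det T).@[y] + 1) / Q.@[y].
  apply: le_trans (_ : 0 <= _); first by rewrite oppr_le0 ler01.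
  by apply: mulr_le0; [rewrite oppr_le0 addr_ge0|rewrite invr_le0 ltW].
by have := H y _ c1; rewrite divfK ?lt_eqF // opprD addNKr oppr_ge0 ler10.
Qed.

End LinearSymbol.

(** Otherwise [P - Q] and [Q] are independent: a relation between them reads [(a - b) Q = a P], so
    either [Q] is a multiple of [P], or [a = b] and [a P = 0]. *)
Lemma extremal_summand_proportional (R : realType) n (P Q : {mpoly R[n]}) :
  extremal_poly P -> P != 0 -> nonneg_poly Q -> nonneg_poly (P - Q) ->
  exists l : R, Q = l *: P.
Proof.
move=> [_ _ ext] P0 Q0 PQ0.
have [//|nl] := EM (exists l : R, Q = l *: P); case: ext; exists (P - Q), Q.
split=> //; last by rewrite subrK.
move=> a b E.
have {}E : (a - b) *: Q = a *: P.
  by apply/eqP; rewrite eq_sym -subr_eq0 scalerBl opprB addrA addrAC -scalerBr E.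
have [ab|ab] := eqVneq (a - b) 0; last first.
  by case: nl; exists ((a - b)^-1 * a); rewrite -scalerA -E scalerA mulVf // scale1r.
have a0 : a = 0.
  move/eqP: E; rewrite ab scale0r eq_sym -mul_mpolyC mulf_eq0 mpolyC_eq0 (negPf P0) orbF.
  by move/eqP.
by split=> //; move/eqP: ab; rewrite a0 sub0r oppr_eq0 => /eqP.
Qed.

Theorem theorem2p4 (R : realType) (d : nat) (hd : (3 <= d)%N)
    (C : 'I_d -> 'I_d -> 'I_d -> 'I_d -> R)
    (hqc : quasiconvex (quad_form C))
    (T : 'M[{mpoly R[d]}]_d) (hT : is_y_matrix (quad_form C) T)
    (hirr : irreducible_elt (\det T)) (hext : extremal_poly (\det T)) :
  extremal_form (quad_form C).
Proof.
split=> // B B0 qcB; have [p0 _ _] := hirr.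
have [Q0 PQ0] := adj_form_bounds hT hqc qcB p0.
have [l lE] := extremal_summand_proportional hext p0 Q0 PQ0.
have [symT homT _] := hT.
(* The choice [c = 1] works unless [l = -1], where [c = -1] gives [1 + c l = 2]. *)
have [c c0 cl] : exists2 c : R, c != 0 & 1 + c * l != 0.
  have [->|l0] := eqVneq l (-1); last first.
    by exists 1; rewrite ?oner_neq0 // mul1r addrC -[1]opprK subr_eq0.
  by exists (-1); rewrite ?oppr_eq0 ?oner_neq0 // mulrNN mulr1 (pnatr_eq0 R 2).
rewrite -mul_mpolyC in lE.
have [||z zE] := det_irreducible_dvd_adj (@factorial_mpoly R d) symT hirr _ _ lE (c := c%:MP).
- by apply: rmorph_unit; rewrite unitfE.
- by rewrite -mpolyCM -mpolyC1 -mpolyCD mpolyC_eq0.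
by move/negP: B0; apply; apply/eqP; apply: mul_2homog_mx_linear_eq0 zE.
Qed.
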